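(* Let $d\ge 1$ and $N\ge 1$ be integers, let $X=[x_1,\dots,x_N]\in\mathbb{R}^{(d+1)\times N}$ be a matrix whose columns all lie in $\mathbb{L}^d$, and let $G = X^{\top} H X$ be its hyperbolic Gramian. Let $G = U\Lambda U^{\top}$ be an eigenvalue decomposition of $G$, where $U\in\mathbb{R}^{N\times(d+1)}$ has orthonormal columns and $\Lambda = \operatorname{diag}(\lambda_0,\lambda_1,\dots,\lambda_d)$ with $\lambda_0\le 0\le \lambda_1\le\dots\le\lambda_d$. Then there exists an $H$-unitary matrix $R\in\mathbb{R}^{(d+1)\times(d+1)}$ such that $$X = R\,|\Lambda|^{1/2}\,U^{\top}.$$
   Context: Let $H = \operatorname{diag}(-1,1,\dots,1) \in \mathbb{R}^{(d+1)\times(d+1)}$. The Lorentzian inner product of $x,y\in\mathbb{R}^{d+1}$ is $[x,y] = x^{\top} H y$. Coordinates of $x\in\mathbb{R}^{d+1}$ are indexed $x_0,\dots,x_d$, and $$\mathbb{L}^d = \{x\in\mathbb{R}^{d+1} : [x,x] = -1,\ x_0>0\}.$$ The hyperbolic Gramian of points $x_1,\dots,x_N\in\mathbb{L}^d$ is $G=([x_i,x_j])_{i,j}=X^{\top}HX$ with $X=[x_1,\dots,x_N]$. For $R\in\mathbb{R}^{(d+1)\times(d+1)}$, the $H$-adjoint is $R^{[*]} = H^{-1}R^{\top}H$ (equivalently $[Rx,y]=[x,R^{[*]}y]$ for all $x,y$). An invertible matrix $R$ is called $H$-unitary if $R^{[*]}=R^{-1}$. The notation $|\Lambda|^{1/2}$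 means $\operatorname{diag}(|\lambda_0|^{1/2},\dots,|\lambda_d|^{1/2})$. The existence of an eigenvalue decomposition with $d+1$ orthonormal columns in $U$ (so $N\ge d+1$) is part of the hypothesis; $\lambda_0,\dots,\lambda_d$ contain all nonzero eigenvalues of $G$. *)

(* Defs.v *)
From HB Require Import structures.
From mathcomp Require Import all_boot all_order all_algebra.
From mathcomp Require Import reals.

Set Implicit Arguments.
Unset Strict Implicit.
Unset Printing Implicit Defensive.

Import Order.TTheory GRing.Theory Num.Theory.
Local Open Scope ring_scope.

(* A realType is a complete Archimedean ordered field, that is, a copy of the
   real numbers.  Vectors of R^(d+1) are columns indexed by 'I_d.+1, so that
   ord0 is the time-like coordinate. *)

Definition lorentz_mx (R : realType) (d : nat) : 'M[R]_d.+1 :=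
  diag_mx (\row_i (if i == ord0 then -1 else 1)).

Arguments lorentz_mx : clear implicits.

Definition lorentz (R : realType) (d : nat) (x y : 'cV[R]_d.+1) : R :=
  (x^T *m lorentz_mx R d *m y) 0 0.

Definition in_hyperboloid (R : realType) (d : nat) (x : 'cV[R]_d.+1) : Prop :=
  lorentz x x = -1 /\ 0 < x ord0 0.

Definition hyp_gramian (R : realType) (d N : nat) (X : 'M[R]_(d.+1, N)) :
    'M[R]_N :=
  X^T *m lorentz_mx R d *m X.

Definition Hadjoint (R : realType) (d : nat) (A : 'M[R]_d.+1) : 'M[R]_d.+1 :=
  invmx (lorentz_mx R d) *m A^T *m lorentz_mx R d.

(* invmx A is A itself when A is singular, hence the explicit unitmx. *)
Definition Hunitary (R : realType) (d : nat) (A : 'M[R]_d.+1) : Prop :=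
  A \in unitmx /\ Hadjoint A = invmx A.

Definition abs_sqrt_diag (R : realType) (n : nat) (l : 'rV[R]_n) : 'M[R]_n :=
  diag_mx (\row_i Num.sqrt `|l 0 i|).

Lemma lorentz_mxK (R : realType) (d : nat) :
  lorentz_mx R d *m lorentz_mx R d = 1%:M.
Proof.
rewrite /lorentz_mx mulmx_diag -diag_const_mx; congr diag_mx.
by apply/rowP => i; rewrite !mxE; case: ifP; rewrite ?mulrNN mulr1.
Qed.

Lemma lorentz_mx_unit (R : realType) (d : nat) : lorentz_mx R d \in unitmx.
Proof. by have [] := mulmx1_unit (lorentz_mxK R d). Qed.

Lemma hyp_gramianE (R : realType) (d N : nat) (X : 'M[R]_(d.+1, N)) i j :
  hyp_gramian X i j = lorentz (col i X) (col j X).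
Proof.
rewrite /lorentz tr_col -row_mul /hyp_gramian [LHS]mxE [RHS]mxE.
by apply: eq_bigr => k _; rewrite [row _ _ _ _]mxE [col _ _ _ _]mxE.
Qed.

Lemma lorentz_adjoint (R : realType) (d : nat) (A : 'M[R]_d.+1)
    (x y : 'cV[R]_d.+1) :
  lorentz (A *m x) y = lorentz x (Hadjoint A *m y).
Proof.
rewrite /lorentz /Hadjoint trmx_mul !mulmxA.
by rewrite (mulmxK (lorentz_mx_unit R d)).
Qed.

(* Main.v *)
Require Import Defs.
From mathcomp Require Import all_boot all_order all_algebra.
From mathcomp Require Import reals.
Import Order.TTheory GRing.Theory Num.Theory.
Local Open Scope ring_scope.

(** The matrices X and |Lambda|^(1/2) U^T have the same Gramian, so the claim is
    an instance of Witt's extension theorem.  A nonzero vector orthogonal to a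
    timelike one is spacelike; hence the form is nondegenerate on the span of X,
    so X and G have the same kernel, and lambda_0 < 0.  The columns of X U are
    then pairwise orthogonal of squared norm lambda_i, and vanish when
    lambda_i = 0.  Normalising the nonzero ones gives an orthonormal family
    containing a timelike vector, which extends to an orthonormal basis: these
    are the columns of R. *)

Lemma lorentzE {R : realType} {d : nat} (x y : 'cV[R]_d.+1) :
  lorentz x y = - (x ord0 0 * y ord0 0)
    + \sum_(i < d) x (lift ord0 i) 0 * y (lift ord0 i) 0.
Proof.
rewrite /lorentz /lorentz_mx mul_mx_diag mxE big_ord_recl !mxE /= mulrN1 mulNr.
by congr (_ + _); apply: eq_bigr => i _; rewrite !mxE /= mulr1.
Qed.

Lemma lorentzC {R : realType} {d : nat} (x y : 'cV[R]_d.+1) :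
  lorentz x y = lorentz y x.
Proof.
rewrite !lorentzE mulrC; congr (_ + _).
by apply: eq_bigr => i _; rewrite mulrC.
Qed.

Lemma lorentzZl {R : realType} {d : nat} (a : R) (x y : 'cV[R]_d.+1) :
  lorentz (a *: x) y = a * lorentz x y.
Proof. by rewrite /lorentz linearZ /= -!scalemxAl mxE. Qed.

Lemma lorentzZr {R : realType} {d : nat} (a : R) (x y : 'cV[R]_d.+1) :
  lorentz x (a *: y) = a * lorentz x y.
Proof. by rewrite lorentzC lorentzZl lorentzC. Qed.

Lemma lorentzBl {R : realType} {d : nat} (x y z : 'cV[R]_d.+1) :
  lorentz (x - y) z = lorentz x z - lorentz y z.
Proof. by rewrite /lorentz linearB /= !mulmxBl !mxE. Qed.

Lemma lorentzBr {R : realType} {d : nat} (x y z : 'cV[R]_d.+1) :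
  lorentz x (y - z) = lorentz x y - lorentz x z.
Proof. by rewrite lorentzC lorentzBl !(lorentzC _ x). Qed.

Lemma lorentz_ge0 {R : realType} {d : nat} {z : 'cV[R]_d.+1} :
  z ord0 0 = 0 -> 0 <= lorentz z z.
Proof.
move=> z0; rewrite lorentzE z0 mul0r oppr0 add0r.
by apply: sumr_ge0 => i _; rewrite -expr2 sqr_ge0.
Qed.

Lemma lorentz_eq0 {R : realType} {d : nat} {z : 'cV[R]_d.+1} :
  z ord0 0 = 0 -> lorentz z z = 0 -> z = 0.
Proof.
move=> z0; rewrite lorentzE z0 mul0r oppr0 add0r => /eqP.
rewrite psumr_eq0; last by move=> i _; rewrite -expr2 sqr_ge0.
move=> /allP zi; apply/colP => i; rewrite mxE.
case: (unliftP ord0 i) => [j|] -> //.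
by have := zi j (mem_index_enum j); rewrite /= mulf_eq0 orbb => /eqP.
Qed.

(** Since [v] and [w] are orthogonal, [w_0 v - v_0 w] has square [w_0^2 [v,v] + v_0^2 [w,w]], which
    is nonnegative because its time coordinate is 0. If [[w,w] <= 0], this forces [w_0 = 0]; then
    [w] is purely spatial and null, hence zero. *)
Lemma timelike_orthogonal_spacelike {R : realType} {d : nat}
    {v w : 'cV[R]_d.+1} :
  lorentz v v < 0 -> lorentz v w = 0 -> w != 0 -> 0 < lorentz w w.
Proof.
move=> v_lt0 vw0 w_neq0; rewrite ltNge; apply/negP => w_le0.
have v0_neq0 : v ord0 0 != 0.
  by apply/eqP => /(@lorentz_ge0 R d); rewrite leNgt v_lt0.
have v0_gt0 : 0 < v ord0 0 ^+ 2 by rewrite exprn_even_gt0.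
(* The time coordinate of w_0 v - v_0 w vanishes. *)
have : 0 <= lorentz (w ord0 0 *: v - v ord0 0 *: w)
                    (w ord0 0 *: v - v ord0 0 *: w).
  by apply: lorentz_ge0; rewrite !mxE mulrC subrr.
rewrite lorentzBl !lorentzBr !lorentzZl !lorentzZr (lorentzC w v) vw0.
rewrite !mulr0 subr0 sub0r opprK !mulrA -!expr2 => sum_ge0.
have w00 : w ord0 0 = 0.
  apply/eqP; apply: contraTT sum_ge0 => w0; rewrite -ltNge.
  have w0_gt0 : 0 < w ord0 0 ^+ 2 by rewrite exprn_even_gt0.
  by rewrite ltr_wnDr // ?pmulr_rlt0 // pmulr_rle0.
have ww0 : lorentz w w = 0 by apply/eqP; rewrite eq_le w_le0 lorentz_ge0.
by move: w_neq0; rewrite (lorentz_eq0 w00 ww0) eqxx.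
Qed.

Lemma col_mulmx {R : pzSemiRingType} {m n p : nat} (A : 'M[R]_(m, n))
    (B : 'M[R]_(n, p)) (j : 'I_p) :
  col j (A *m B) = A *m col j B.
Proof.
by apply/colP => i; rewrite !mxE; apply: eq_bigr => k _; rewrite mxE.
Qed.

(** Each column of [X *m V] is orthogonal to every column of [X]. Orthogonality to the timelike one
    makes it spacelike or zero; lying in their span, it is also orthogonal to itself, so it is
    zero. *)
Lemma hyp_gramian_ker {R : realType} {d N p : nat} {X : 'M[R]_(d.+1, N)}
    {j : 'I_N} (V : 'M[R]_(N, p)) :
  lorentz (col j X) (col j X) < 0 -> hyp_gramian X *m V = 0 -> X *m V = 0.
Proof.
move=> xj_lt0 GV0; apply/matrixP => i k; rewrite [RHS]mxE.
have GVk : X^T *m lorentz_mx R d *m (X *m col k V) = 0.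
  by rewrite mulmxA -/(hyp_gramian X) -col_mulmx GV0 col0.
have [/colP/(_ i)|XVk] := eqVneq (X *m col k V) 0.
  by rewrite -col_mulmx !mxE.
have xjXV : lorentz (col j X) (X *m col k V) = 0.
  by rewrite /lorentz tr_col -!row_mul GVk !mxE.
have := timelike_orthogonal_spacelike xj_lt0 xjXV XVk.
by rewrite /lorentz trmx_mul -!mulmxA (mulmxA X^T) GVk mulmx0 mxE ltxx.
Qed.

(** Induction on the number of columns outside [s], replacing one of them at each step. As
    [ord0 \in s], a timelike column is already present, so every new orthogonal vector is spacelike
    and can be normalised to square 1. *)
Lemma lorentz_orthonormal_completion {R : realType} {d : nat} (M : 'M[R]_d.+1)
    (s : {set 'I_d.+1}) :
    ord0 \in s ->
    {in s &, forall i j, lorentz (col i M) (col j M) = lorentz_mx R d i j} ->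
  exists2 A : 'M[R]_d.+1, hyp_gramian A = lorentz_mx R d &
    {in s, forall i, col i A = col i M}.
Proof.
have [n] := ubnP #|~: s|; elim: n => // n IHn in M s *.
rewrite ltnS => le_n s0 Ms.
have [/eqP/setP sT|/set0Pn[k]] := boolP (~: s == set0).
  have {}sT i : i \in s by have := sT i; rewrite !inE => /negbFE.
  exists M => //; apply/matrixP => i j.
  by rewrite hyp_gramianE Ms.
rewrite inE => ks.
(* Zeroing the columns outside [s] makes the matrix singular. A left kernel vector [u] is
   Euclidean-orthogonal to the columns in [s], so [H u^T] is Lorentz-orthogonal to them because
   [H^2 = 1]. *)
pose M1 : 'M[R]_d.+1 := \matrix_(i, j) (if j \in s then M i j else 0).
have /eqP/det0P[u u_neq0 uM1] : \det M1 = 0.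
  rewrite (expand_det_col _ k) big1 // => i _.
  by rewrite mxE (negbTE ks) mul0r.
pose w := lorentz_mx R d *m u^T.
have w_neq0 : w != 0.
  apply: contra_neq u_neq0 => /(congr1 (mulmx (lorentz_mx R d))).
  by rewrite mulmxA lorentz_mxK mul1mx mulmx0 => /(congr1 trmx); rewrite trmxK trmx0.
have wM i : i \in s -> lorentz w (col i M) = 0.
  move=> si; rewrite lorentzC /lorentz -mulmxA (mulmxA (lorentz_mx R d)).
  rewrite lorentz_mxK mul1mx mxE.
  have /rowP/(_ i) := uM1; rewrite !mxE => u0; rewrite -[RHS]u0.
  by apply: eq_bigr => l _; rewrite !mxE si mulrC.
have w_gt0 : 0 < lorentz w w.
  apply: (@timelike_orthogonal_spacelike _ _ (col ord0 M)) => //.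
    by rewrite Ms // !mxE eqxx mulr1n ltrN10.
  by rewrite lorentzC wM.
pose w1 := (Num.sqrt (lorentz w w))^-1 *: w.
have w1_norm : lorentz w1 w1 = 1.
  rewrite lorentzZl lorentzZr mulrA -invfM -expr2 sqr_sqrtr ?ltW //.
  by rewrite mulVf // gt_eqF.
have w1M i : i \in s -> lorentz w1 (col i M) = 0.
  by move=> si; rewrite lorentzZl wM // mulr0.
pose M2 : 'M[R]_d.+1 := \matrix_(i, j) (if j == k then w1 i 0 else M i j).
have M2k : col k M2 = w1 by apply/colP => i; rewrite !mxE eqxx.
have neq_k i : i \in s -> i != k by apply: contraTneq => ->.
have M2s i : i \in s -> col i M2 = col i M.
  by move=> /neq_k/negbTE ik; apply/colP => l; rewrite !mxE ik.
have k0 : k != ord0 by rewrite eq_sym neq_k.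
have [||i j|A HA As] := IHn M2 (k |: s).
- apply: leq_trans le_n; apply: proper_card.
  rewrite properC properE subsetUr; apply/subsetPn; exists k => //.
  by rewrite setU11.
- by rewrite inE s0 orbT.
- rewrite !in_setU1 => /predU1P[->|si] /predU1P[->|sj].
  + by rewrite M2k w1_norm !mxE eqxx (negbTE k0).
  + by rewrite M2k M2s // w1M // !mxE (eq_sym k j) (negbTE (neq_k _ sj)).
  + by rewrite M2k M2s // lorentzC w1M // !mxE (negbTE (neq_k _ si)).
  + by rewrite !M2s // Ms.
exists A => // i si; rewrite As ?M2s //.
by rewrite in_setU1 si orbT.
Qed.

Lemma hyp_gramian_Hunitary {R : realType} {d : nat} {A : 'M[R]_d.+1} :
  hyp_gramian A = lorentz_mx R d -> Hunitary A.
Proof.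
move=> HA.
have AA : Hadjoint A *m A = 1%:M.
  rewrite /Hadjoint -!mulmxA (mulmxA A^T) -/(hyp_gramian A) HA.
  by rewrite mulVmx // lorentz_mx_unit.
have [_ Au] := mulmx1_unit AA.
by split=> //; rewrite -[LHS](mulmxK Au) AA mul1mx.
Qed.

Theorem proposition3p3 (R : realType) (d N : nat) (hd : (1 <= d)%N)
    (hN : (1 <= N)%N) (X : 'M[R]_(d.+1, N))
    (hX : forall j : 'I_N, in_hyperboloid (col j X))
    (U : 'M[R]_(N, d.+1)) (lambda : 'rV[R]_d.+1)
    (hU : U^T *m U = 1%:M)
    (hG : hyp_gramian X = U *m diag_mx lambda *m U^T)
    (hlambda0 : lambda 0 ord0 <= 0)
    (hlambda_ge0 : forall i : 'I_d.+1, (1 <= i)%N -> 0 <= lambda 0 i)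
    (hlambda_sorted : forall i j : 'I_d.+1,
      (1 <= i)%N -> (i <= j)%N -> lambda 0 i <= lambda 0 j) :
  exists A : 'M[R]_d.+1,
    Hunitary A /\ X = A *m abs_sqrt_diag lambda *m U^T.
Proof.
pose j0 : 'I_N := Ordinal hN.
have x0 : lorentz (col j0 X) (col j0 X) = -1 by case: (hX j0).
have x0_lt0 : lorentz (col j0 X) (col j0 X) < 0 by rewrite x0 ltrN10.
have lambda0_lt0 : lambda 0 ord0 < 0.
  (* If [lambda_0 = 0], then [G] is positive semidefinite, against its diagonal entry -1. *)
  rewrite lt_neqAle hlambda0 andbT; apply: contraTneq x0_lt0 => l0.
  rewrite -leNgt -hyp_gramianE hG mul_mx_diag mxE.
  apply: sumr_ge0 => i _; rewrite !mxE mulrAC -expr2 mulr_ge0 ?sqr_ge0 //.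
  by have [->|i0] := eqVneq i ord0; [rewrite l0 | rewrite hlambda_ge0 // lt0n].
(* [U *m U^T] need not be the identity, but [G] kills [1 - U *m U^T], hence so does [X]. *)
have XUU : X = X *m U *m U^T.
  apply/eqP; rewrite -subr_eq0 -mulmxA -{1}[X]mulmx1 -mulmxBr; apply/eqP.
  apply: (hyp_gramian_ker _ x0_lt0).
  by rewrite hG mulmxBr mulmx1 -!mulmxA (mulmxA U^T) hU mul1mx subrr.
have GXU : hyp_gramian (X *m U) = diag_mx lambda.
  rewrite /hyp_gramian trmx_mul -!mulmxA (mulmxA (lorentz_mx R d)).
  rewrite (mulmxA X^T) (mulmxA X^T) -/(hyp_gramian X) hG -!mulmxA hU mulmx1.
  by rewrite mulmxA hU mul1mx.
have XU0 j : lambda 0 j = 0 -> col j (X *m U) = 0.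
  move=> lj0; rewrite col_mulmx; apply: (hyp_gramian_ker _ x0_lt0).
  rewrite -col_mulmx hG -mulmxA hU mulmx1 mul_mx_diag.
  by apply/colP => i; rewrite !mxE lj0 mulr0.
pose sq j := Num.sqrt `|lambda 0 j|.
have sq_neq0 j : lambda 0 j != 0 -> sq j != 0.
  by move=> lj; rewrite gt_eqF // sqrtr_gt0 normr_gt0.
(* Where [lambda_j = 0] the inverse is 0 by convention; such columns lie outside the set being
   completed, so their values do not matter. *)
pose M : 'M[R]_d.+1 := \matrix_(i, j) ((sq j)^-1 * (X *m U) i j).
have colM j : col j M = (sq j)^-1 *: col j (X *m U).
  by apply/colP => i; rewrite !mxE.
have [||A HA As] := @lorentz_orthonormal_completion R d M
  [set j | lambda 0 j != 0].
- by rewrite inE lt_eqF.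
- move=> i j; rewrite !inE => li lj.
  rewrite !colM lorentzZl lorentzZr -hyp_gramianE GXU !mxE.
  have [<-|] := eqVneq i j; last by rewrite !mulr0n !mulr0.
  rewrite !mulr1n mulrA -invfM -expr2 sqr_sqrtr ?normr_ge0 //.
  (* What remains is [lambda_i / |lambda_i|]: -1 at [ord0] and 1 elsewhere, as on the diagonal of
     [H]. *)
  have [->|i0] := eqVneq i ord0.
    by rewrite ltr0_norm // invrN mulNr mulVf // lt_eqF.
  by rewrite ger0_norm ?mulVf // hlambda_ge0 // lt0n.
exists A; split; first exact: hyp_gramian_Hunitary.
rewrite {1}XUU; congr (_ *m _).
apply/matrixP => i j; rewrite /abs_sqrt_diag mul_mx_diag !mxE -/(sq j).
(* For [lambda_j = 0] both sides vanish, whatever column the completion chose. *)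
have [lj|lj] := eqVneq (lambda 0 j) 0.
  have /colP/(_ i) := XU0 j lj; rewrite !mxE => ->.
  by rewrite /sq lj normr0 sqrtr0 mulr0.
have /colP/(_ i) : col j A = col j M by apply: As; rewrite inE.
rewrite !mxE => ->.
by rewrite mulrAC mulVf ?mul1r // sq_neq0.
Qed.
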